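(* Let $\mathbb{P}_0,\mathbb{P}_1,\dots,\mathbb{P}_n$ be such that each $\mathbb{P}_k$ is a basis of the space $\mathcal{V}_k^d$ of orthogonal polynomials of degree $k$ in $d$ variables. Consider a signal model with underlying variety $V=V(\langle\mathbb{P}_n\rangle)$ such that $|V|=\dim\Pi_{n-1}^d$, and let the basis of its module be given by $(\mathbb{P}_i)_{i=0}^{n-1}$. Then there exists an insignificantly different signal model with orthogonal Fourier transform.
   Context: $\Pi^d$ is the space of polynomials in $d$ variables $x=(x_1,\dots,x_d)$ and $\Pi^d_m$ the subspace of polynomials of degree at most $m$. An inner product $\langle f,g\rangle=\int_{\mathbb{R}^d}f(x)g(x)\,d\mu(x)$ on $\Pi^d$ is fixed, where $\mu$ is a measure on $\mathbb{R}^d$ whose support has non-empty interior. The space of orthogonal polynomials of degree $k$ is $\mathcal{V}_k^d=\{p\in\Pi_k^d\mid\langle p,q\rangle=0\text{ for all }q\in\Pi_{k-1}^d\}$; it has dimension $\binom{k+d-1}{k}$, and a basis of it is written $\mathbb{P}_k=(P^k_\alpha)_{|\alpha|=k}$. $\langle\mathbb{P}_n\rangle$ is the ideal generated by all entries of $\mathbb{P}_n$, and $V(\langle\mathbb{P}_n\rangle)$ is the set of common zeros of all these entries. An algebraic signal model is a triple $(\mathscr{A},M,\Phi)$ of an algebra $\mathscr{A}$, a free $\mathscr{A}$-module $M$, and a bijection $\Phi\colon s\mapsto\sum_i s_ib_i$ from coordinate space to $M$ determined by a basis $(b_i)$ of $M$. The signal model with underlying variety $V$ has $\mathscr{A}=\Pi^d/I$,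 where $I=\langle\mathbb{P}_n\rangle$, and $M=\mathscr{A}$ as regular module. Its Fourier transform is the Chinese remainder isomorphism $M\to\bigoplus_{\alpha\in V}\Pi^d/\langle x_1-\alpha_1,\dots,x_d-\alpha_d\rangle$, $p\mapsto(p(\alpha))_\alpha$. With respect to a basis $b$ of $M$ and bases $[a_\alpha]$ ($a_\alpha$ a nonzero scalar) of the one-dimensional summands, it is given by the matrix $\operatorname{diag}(1/a_\alpha)_{\alpha\in V}\,[f(\alpha)]_{\alpha\in V,\,f\in b}$; the bases of the one-dimensional summands may be chosen freely. The Fourier transform is called orthogonal if this (square) matrix is orthogonal. When all coefficients and varieties are real, the structures may be considered over $\mathbb{R}$. Two signal models $(\mathscr{A},M,\Phi_1)$ and $(\mathscr{A},M,\Phi_2)$ with bases of the modules given by sets of orthogonal polynomials $\mathbb{P}^{(1)}$ and $\mathbb{P}^{(2)}$ are called insignificantly different if $\mathbb{P}^{(1)}$ and $\mathbb{P}^{(2)}$ are orthogonal with respect to the same positive definite linear functional (so that they may differ by the choice of bases in the spaces $\mathcal{V}^d_k$). *)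

(* Defs.v *)
From HB Require Import structures.
From mathcomp Require Import all_boot all_order all_algebra.
From mathcomp Require Import all_classical all_reals all_analysis.
From mathcomp Require Import finmap.
From mathcomp Require mpoly.
(* The notations of [mpoly] are incompatible with those of MathComp-Analysis. *)
Import -(notations) mpoly.
Import Order.TTheory GRing.Theory Num.Theory.
Import numFieldNormedType.Exports.

Set Implicit Arguments.
Unset Strict Implicit.
Unset Printing Implicit Defensive.

Local Open Scope classical_set_scope.
Local Open Scope ring_scope.
Local Open Scope quotient_scope.

Section Polynomials.
Variables (R : realType) (d : nat).

Definition peval (p : mpoly d R) (x : 'rV[R]_d) : R := meval (x ord0) p.

(* [mpoly.msize p] is the total degree of p plus one, and 0 for p = 0. Hence
   this is the space of polynomials of degree at most m - 1, zero for m = 0. *)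
Definition poly_lt (m : nat) : set (mpoly d R) :=
  [set p | (mpoly.msize p <= m)%N].

Definition is_basis (S : set (mpoly d R)) (J : finType) (b : J -> mpoly d R) :=
  [/\ forall j, S (b j),
      forall c : J -> R, \sum_j c j *: b j = 0 -> forall j, c j = 0
    & forall p, S p -> exists c : J -> R, p = \sum_j c j *: b j].

Definition has_dim (S : set (mpoly d R)) (N : nat) :=
  exists b : 'I_N -> mpoly d R, is_basis S b.

(* A family (P_alpha), alpha a multi-index, packs the sequence P_0, P_1, ...
   with P_k = (P_alpha)_{|alpha| = k}. *)
Definition block (P : multinom d -> mpoly d R) (k : nat)
    (a : {a : bmultinom d k.+1 | mdeg a == k}) : mpoly d R :=
  P (val (val a)).

(* [L : mpoly d R -> R] stands for a linear functional, and the bilinear form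
   is <p, q> = L (p q). *)
Definition orth_space (L : mpoly d R -> R) (k : nat) : set (mpoly d R) :=
  [set p | poly_lt k.+1 p /\ forall q, poly_lt k q -> L (p * q) = 0].

Definition orth_basis (L : mpoly d R -> R) (P : multinom d -> mpoly d R)
    (k : nat) :=
  is_basis (orth_space L k) (block P (k := k)).

Definition positive_definite (L : mpoly d R -> R) :=
  forall p, p != 0 -> 0 < L (p * p).

End Polynomials.

Section Measure.
Variables (R : realType) (d : nat).

(* R^d with its Borel sigma-algebra *)
Definition borelRd := g_sigma_algebraType (@open 'rV[R]_d).

Definition measure_support (mu : {measure set borelRd -> \bar R}) : set 'rV[R]_d :=
  [set x | forall U : set 'rV[R]_d, open U -> U x -> (0 < mu U)%E].

Definition finite_moments (mu : {measure set borelRd -> \bar R}) :=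
  forall p : mpoly d R, mu.-integrable setT (fun x => (peval p x)%:E).

Definition integral_functional (mu : {measure set borelRd -> \bar R})
    (p : mpoly d R) : R :=
  \int[mu]_x peval p x.

End Measure.

Section QuotientAlgebra.
Variables (R : realType) (d : nat) (J : finType) (F : J -> mpoly d R).

Definition gen_ideal (p : mpoly d R) : bool :=
  `[< exists c : J -> mpoly d R, p = \sum_j c j * F j >].

Fact gen_ideal_zmod_closed : zmod_closed gen_ideal.
Proof.
split=> [|p q /asboolP[c ->] /asboolP[e ->]]; apply/asboolP.
  by exists (fun=> 0); rewrite big1// => j _; rewrite mul0r.
exists (fun j => c j - e j); rewrite -sumrB; apply: eq_bigr => j _.
by rewrite mulrBl.
Qed.

HB.instance Definition _ :=
  GRing.isZmodClosed.Build (mpoly d R) gen_ideal gen_ideal_zmod_closed.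

Fact gen_idealMl p q : q \in gen_ideal -> p * q \in gen_ideal.
Proof.
move=> /asboolP[c ->]; apply/asboolP; exists (fun j => p * c j).
by rewrite mulr_sumr; apply: eq_bigr => j _; rewrite mulrA.
Qed.

(* The library makes this quotient a ring for proper ideals only; the structure
   built below also covers the unit ideal (zero ring). *)
Definition quot_alg :=
  {ideal_quot (GRing.ZmodClosed.clone (mpoly d R) gen_ideal _)}.

HB.instance Definition _ := Choice.on quot_alg.
HB.instance Definition _ := EqQuotient.on quot_alg.
HB.instance Definition _ := GRing.Zmodule.on quot_alg.

Local Notation pi := (\pi_quot_alg).

Definition qone : quot_alg := pi 1.
Definition qmul (x y : quot_alg) : quot_alg := pi (repr x * repr y).
Definition qscale (a : R) (x : quot_alg) : quot_alg := pi (a *: repr x).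

Fact pi_eqP p q : reflect (pi p = pi q) (p - q \in gen_ideal).
Proof. by rewrite Quotient.idealrBE; apply: eqP. Qed.

Fact pi_add p q : pi (p + q) = pi p + pi q.
Proof. by rewrite !piE. Qed.

Fact repr_pi p : repr (pi p) - p \in gen_ideal.
Proof. by apply/pi_eqP; rewrite reprK. Qed.

Fact pi_mul p q : pi (p * q) = qmul (pi p) (pi q).
Proof.
apply/esym/pi_eqP; rewrite -[_ - _](subrKA (repr (pi p) * q)) -mulrBr -mulrBl.
apply: rpredD; first by rewrite gen_idealMl ?repr_pi.
by rewrite mulrC gen_idealMl ?repr_pi.
Qed.

Fact pi_scale a p : pi (a *: p) = qscale a (pi p).
Proof.
by apply/esym/pi_eqP; rewrite -scalerBr -mul_mpolyC gen_idealMl ?repr_pi.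
Qed.

Fact pi_surj (x : quot_alg) : exists p, x = pi p.
Proof. by exists (repr x); rewrite reprK. Qed.

Fact qmulA : associative qmul.
Proof.
move=> x y z; have [p ->] := pi_surj x; have [q ->] := pi_surj y.
have [r ->] := pi_surj z.
by rewrite -(pi_mul q r) -(pi_mul p (q * r)) -(pi_mul p q) -pi_mul mulrA.
Qed.

Fact qmulC : commutative qmul.
Proof. by move=> x y; rewrite /qmul mulrC. Qed.

Fact qmul1 : left_id qone qmul.
Proof.
by move=> x; have [p ->] := pi_surj x; rewrite -(pi_mul 1 p) mul1r.
Qed.

Fact qmulDl : left_distributive qmul +%R.
Proof.
move=> x y z; have [p ->] := pi_surj x; have [q ->] := pi_surj y.
have [r ->] := pi_surj z.
by rewrite -pi_add -(pi_mul (p + q)) -(pi_mul p) -(pi_mul q) mulrDl pi_add.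
Qed.

HB.instance Definition _ :=
  GRing.Zmodule_isComPzRing.Build quot_alg qmulA qmulC qmul1 qmulDl.

Fact qscaleA a b x : qscale a (qscale b x) = qscale (a * b) x.
Proof.
have [p ->] := pi_surj x.
by rewrite -(pi_scale b p) -(pi_scale a (b *: p)) -(pi_scale _ p) scalerA.
Qed.

Fact qscale1 : left_id 1 qscale.
Proof.
by move=> x; have [p ->] := pi_surj x; rewrite -(pi_scale 1 p) scale1r.
Qed.

Fact qscaleDr : right_distributive qscale +%R.
Proof.
move=> a x y; have [p ->] := pi_surj x; have [q ->] := pi_surj y.
by rewrite -pi_add -(pi_scale a (p + q)) -(pi_scale a p) -(pi_scale a q)
  scalerDr pi_add.
Qed.

Fact qscaleDl x : {morph qscale^~ x : a b / a + b}.
Proof.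
move=> a b; have [p ->] := pi_surj x.
by rewrite -(pi_scale (a + b) p) -(pi_scale a p) -(pi_scale b p) scalerDl
  pi_add.
Qed.

HB.instance Definition _ := GRing.Zmodule_isLmodule.Build R quot_alg
  qscaleA qscale1 qscaleDr qscaleDl.

Fact qscaleAl (a : R) (x y : quot_alg) : a *: (x * y) = (a *: x) * y.
Proof.
have [p ->] := pi_surj x; have [q ->] := pi_surj y.
rewrite [LHS](_ : _ = qscale a (qmul (pi p) (pi q)))//.
rewrite [RHS](_ : _ = qmul (qscale a (pi p)) (pi q))//.
by rewrite -(pi_mul p q) -(pi_scale a p) -(pi_scale a (p * q)) -(pi_mul _ q)
  scalerAl.
Qed.

End QuotientAlgebra.

Section SignalModel.
Variables (R : realType) (d : nat) (I : finType) (F : I -> mpoly d R).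

Definition coord_map (J : finType) (b : J -> quot_alg F)
    (s : {ffun J -> R}) : quot_alg F :=
  \sum_j s j *: b j.

(* A signal model (A, M, Phi) with A = Pi^d / <F> and M = A, the regular
   module; A and M are fixed by F, so only the basis and Phi vary. *)
Record signal_model (J : finType) := SignalModel {
  basis : J -> quot_alg F;
  Phi := coord_map basis;
  Phi_bij : bijective Phi
}.

Definition variety : set 'rV[R]_d := [set x | forall i, peval (F i) x = 0].

(* Pi^d / <x_1 - alpha_1, ..., x_d - alpha_d> is identified with R by
   evaluation at alpha; the value at alpha does not depend on the chosen
   representative as soon as alpha lies in the variety of F. *)
Definition fourier (x : quot_alg F) (alpha : 'rV[R]_d) : R :=
  peval (repr x) alpha.

Fact fourier_pi (p : mpoly d R) (alpha : 'rV[R]_d) : variety alpha ->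
  fourier (\pi_(quot_alg F) p) alpha = peval p alpha.
Proof.
move=> Valpha; apply/eqP; rewrite -subr_eq0 -mevalB.
have /asboolP[c ->] := repr_pi F p.
rewrite raddf_sum big1// => i _; rewrite /= mevalM.
by have := Valpha i; rewrite /peval => ->; rewrite mulr0.
Qed.

(* Matrix of the Fourier transform with respect to the basis of the model and
   the bases [a_alpha] of the summands; meaningful for a finite variety, since
   [fset_set] is empty on infinite sets. *)
Definition fourier_mx (J : finType) (M : signal_model J) (a : 'rV[R]_d -> R) :
    'M[R]_(#|{: fset_set variety}|, #|J|) :=
  \matrix_(i, j) let alpha := val (enum_val i) in
    (a alpha)^-1 * fourier (basis M (enum_val j)) alpha.

Definition orthogonal_mx (m n : nat) (A : 'M[R]_(m, n)) :=
  A *m A^T = 1%:M /\ A^T *m A = 1%:M.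

Definition orthogonal_fourier (J : finType) (M : signal_model J) :=
  exists a : 'rV[R]_d -> R,
    (forall alpha, variety alpha -> a alpha != 0) /\
    orthogonal_mx (fourier_mx M a).

(* The basis of the module is (P_0, ..., P_{n-1}). *)
Definition has_basis (n : nat) (M : signal_model (bmultinom d n))
    (P : multinom d -> mpoly d R) :=
  forall a : bmultinom d n, basis M a = \pi_(quot_alg F) (P a).

(* M1 and M2 have the same algebra and module by typing. For k < n both blocks
   of degree k are bases of [orth_space L k], hence have the same span. *)
Definition insignificantly_different (n : nat)
    (M1 M2 : signal_model (bmultinom d n)) (P1 P2 : multinom d -> mpoly d R) :=
  [/\ has_basis M1 P1, has_basis M2 P2
    & exists L : mpoly d R -> R,
      [/\ scalar L, positive_definite L
        & forall k, (k < n)%N -> orth_basis L P1 k /\ orth_basis L P2 k]].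

End SignalModel.

(* Main.v *)
(* Let L be the integral against mu and Q an orthonormal basis obtained by
   Gram-Schmidt inside each V_k, k < n. For x in V the kernel
   K_x = sum_j Q_j(x) Q_j satisfies L(f K_x) = f(x) for every f of degree at
   most n, since the part of f in V_n vanishes at x. With t_i the i-th
   coordinate function, x_i K_y(x) = L(t_i K_x K_y) = y_i K_x(y), and K is
   symmetric, so K_x(y) = 0 for distinct x, y in V. The rows of
   [Q_j(x) / sqrt(K_x(x))] are thus orthonormal, and the matrix is square by
   the cardinality hypothesis. *)
Require Import Defs.
From mathcomp Require Import all_boot all_order all_algebra.
From mathcomp Require Import all_classical all_reals all_analysis.
From mathcomp Require Import finmap.
From mathcomp Require mpoly.
Import -(notations) mpoly.
Import Order.TTheory GRing.Theory Num.Theory.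
Import numFieldNormedType.Exports.

Set Implicit Arguments.
Unset Strict Implicit.
Unset Printing Implicit Defensive.

Local Open Scope classical_set_scope.
Local Open Scope ring_scope.
Local Open Scope quotient_scope.

(** * Linear combinations of finite families *)

Section LinearSpan.
Variables (R : pzRingType) (V : lmodType R).

Definition in_span (J : finType) (b : J -> V) (v : V) :=
  exists c : J -> R, v = \sum_j c j *: b j.

Lemma in_span_self (J : finType) (b : J -> V) j : in_span b (b j).
Proof.
exists (fun i => (i == j)%:R); rewrite (bigD1 j)//= eqxx scale1r big1 ?addr0//.
by move=> i /negPf ->; rewrite scale0r.
Qed.

Lemma in_spanD (J : finType) (b : J -> V) u v :
  in_span b u -> in_span b v -> in_span b (u + v).
Proof.
move=> [c ->] [e ->]; exists (fun j => c j + e j).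
by rewrite -big_split; apply: eq_bigr => j _; rewrite scalerDl.
Qed.

Lemma in_spanZ (J : finType) (b : J -> V) a u :
  in_span b u -> in_span b (a *: u).
Proof.
move=> [c ->]; exists (fun j => a * c j).
by rewrite scaler_sumr; apply: eq_bigr => j _; rewrite scalerA.
Qed.

Lemma in_span_sum (I J : finType) (b : J -> V) (u : I -> V) :
  (forall i, in_span b (u i)) -> in_span b (\sum_i u i).
Proof.
move=> bu; elim/big_rec: _ => [|i v _]; last exact: in_spanD.
by exists (fun=> 0); rewrite big1// => j _; rewrite scale0r.
Qed.

Lemma in_span_trans (I J : finType) (b : I -> V) (e : J -> V) v :
  (forall i, in_span e (b i)) -> in_span b v -> in_span e v.
Proof. by move=> eb [c ->]; apply: in_span_sum => i; exact/in_spanZ/eb. Qed.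

Lemma in_span_lift n (b : 'I_n.+1 -> V) v :
  in_span (fun i => b (lift ord0 i)) v -> in_span b v.
Proof. by apply: in_span_trans => i; exact: (in_span_self b). Qed.

End LinearSpan.

(** * Gram-Schmidt for an abstract real inner product *)

Section GramSchmidt.
Variables (R : rcfType) (V : lmodType R) (ip : V -> V -> R).
Hypothesis ip_linear : forall v, scalar (ip^~ v).
Hypothesis ipC : forall u v, ip u v = ip v u.
Hypothesis ip_gt0 : forall v, v != 0 -> 0 < ip v v.

Let ipD u v w : ip (u + v) w = ip u w + ip v w.
Proof. by have := ip_linear w 1 u v; rewrite /= scale1r mul1r. Qed.

Let ip0 w : ip 0 w = 0.
Proof. by apply: (addrI (ip 0 w)); rewrite -ipD !addr0. Qed.

Let ipZ a u w : ip (a *: u) w = a * ip u w.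
Proof. by have := ip_linear w a u 0; rewrite /= !addr0 ip0 addr0. Qed.

Let ipN u w : ip (- u) w = - ip u w.
Proof. by rewrite -scaleN1r ipZ mulN1r. Qed.

Let ip_sum (J : finType) (u : J -> V) w : ip (\sum_j u j) w = \sum_j ip (u j) w.
Proof. by apply: (big_morph (ip^~ w)) => // u' v; exact: ipD. Qed.

Lemma orthonormal_coord (J : finType) (q : J -> V) (c : J -> R) j :
  (forall i j, ip (q i) (q j) = (i == j)%:R) ->
  ip (\sum_i c i *: q i) (q j) = c j.
Proof.
move=> q1; rewrite ip_sum (bigD1 j)//= ipZ q1 eqxx mulr1 big1 ?addr0//.
by move=> i /negPf ij; rewrite ipZ q1 ij mulr0.
Qed.

(** By induction on [n]: the tail of [b] is orthonormalised first, then [b ord0] loses its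
    projection on the result and is normalised. Spans are tracked in both directions so that the new
    family can replace [b] as a basis. *)
Lemma gram_schmidt n (b : 'I_n -> V) :
  (forall c : 'I_n -> R, \sum_j c j *: b j = 0 -> forall j, c j = 0) ->
  exists q : 'I_n -> V,
    [/\ forall i j, ip (q i) (q j) = (i == j)%:R,
        forall i, in_span b (q i) & forall i, in_span q (b i)].
Proof.
elim: n b => [|n IHn] b b_free; first by exists b; split=> -[].
have [c c0 j|q [q1 bq qb]] := IHn (fun i => b (lift ord0 i)).
  (* A relation on the tail becomes one on all of [b] once it is extended by the coefficient 0 at
     [ord0]. *)
  have := b_free (oapp c 0 \o unlift ord0).
  rewrite big_ord_recl /= unlift_none scale0r add0r.
  move=> /(_ _ (lift ord0 j)); rewrite /= liftK; apply.
  by rewrite -[RHS]c0; apply: eq_bigr => i _; rewrite liftK.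
pose u := b ord0 - \sum_j ip (b ord0) (q j) *: q j.
(* If [u] were 0, then [b ord0] would lie in the span of the tail, and the coefficient -1 at [ord0]
   would give a nontrivial relation. *)
have u_neq0 : u != 0.
  apply/eqP => u0.
  have [c /esym/eqP] : in_span (fun i => b (lift ord0 i)) (b ord0).
    have /eqP -> : b ord0 == \sum_j ip (b ord0) (q j) *: q j.
      by rewrite -subr_eq0; apply/eqP.
    by apply: in_span_sum => j; exact: in_spanZ.
  rewrite -subr_eq0 => /eqP bc.
  have /(_ _ ord0) := b_free (oapp c (- 1) \o unlift ord0).
  rewrite big_ord_recl /= unlift_none scaleN1r addrC.
  under eq_bigr do rewrite liftK /=.
  by move=> /(_ bc)/eqP; rewrite oppr_eq0 oner_eq0.
have uq j : ip u (q j) = 0.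
  by rewrite ipD ipN orthonormal_coord// subrr.
pose s := Num.sqrt (ip u u).
have s_gt0 : 0 < s by rewrite sqrtr_gt0 ip_gt0.
have bu : in_span b u.
  apply: in_spanD; first exact: in_span_self.
  rewrite -scaleN1r; apply/in_spanZ/in_span_sum => j.
  exact/in_spanZ/in_span_lift.
pose q' i := oapp q (s^-1 *: u) (unlift ord0 i).
have q'S j : q' (lift ord0 j) = q j by rewrite /q' liftK.
have q'0 : q' ord0 = s^-1 *: u by rewrite /q' unlift_none.
have q'q v : in_span q v -> in_span q' v.
  by apply: in_span_trans => i; rewrite -q'S; exact: in_span_self.
exists q'; split=> [i j|i|i].
- case: (unliftP ord0 i) => [i'|] ->; case: (unliftP ord0 j) => [j'|] ->.
  + by rewrite !q'S q1 (inj_eq (@lift_inj _ _)).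
  + by rewrite q'S q'0 ipC ipZ uq mulr0.
  + by rewrite q'S q'0 ipZ uq mulr0.
  + rewrite q'0 ipZ ipC ipZ eqxx -[ip u u]sqr_sqrtr; last first.
      by rewrite ltW// ip_gt0.
    by rewrite -/s expr2 mulrA -invfM mulVf// mulf_neq0// gt_eqF.
- case: (unliftP ord0 i) => [i'|] ->; last by rewrite q'0; exact: in_spanZ.
  by rewrite q'S; exact: in_span_lift.
- case: (unliftP ord0 i) => [i'|] ->; first exact: q'q.
  have -> : b ord0 = s *: q' ord0 + \sum_j ip (b ord0) (q j) *: q j.
    by rewrite q'0 scalerA mulfV ?gt_eqF// scale1r subrK.
  apply: in_spanD; first exact/in_spanZ/in_span_self.
  by apply/q'q/in_span_sum => j; exact/in_spanZ/in_span_self.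
Qed.

End GramSchmidt.

(** * Cardinality of bases, degree bounds and evaluation *)

Section Bases.
Variables (R : realType) (d : nat).
Implicit Types S : set (mpoly d R).

(** Expanding [b] in [e] and [e] back in [b] gives coordinate matrices whose product is the
    identity, because [b] is free. An identity matrix of size [#|I|] factors only through a
    dimension at least as large. *)
Lemma is_basis_card_le S (I J : finType) (b : I -> mpoly d R)
    (e : J -> mpoly d R) :
  is_basis S b -> is_basis S e -> (#|I| <= #|J|)%N.
Proof.
move=> [Sb b_free b_gen] [Se _ e_gen].
have /choice[A bA] i := e_gen _ (Sb i).
have /choice[C eC] j := b_gen _ (Se j).
pose MA := \matrix_(i < #|I|, j < #|J|) A (enum_val i) (enum_val j).
pose MC := \matrix_(j < #|J|, i < #|I|) C (enum_val j) (enum_val i).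
apply: (@mulmx1_min _ _ _ MA MC); apply/matrixP => i k.
rewrite !mxE; under eq_bigr do rewrite !mxE.
rewrite -(big_enum_val (fun j => A (enum_val i) j * C j (enum_val k))).
apply/eqP; rewrite -subr_eq0; apply/eqP.
rewrite -(inj_eq enum_val_inj).
(* Freeness is applied to a row of [MA *m MC - 1]: both parts of the combination expand
   [b (enum_val i)]. *)
have := b_free (fun k => \sum_j A (enum_val i) j * C j k - (enum_val i == k)%:R).
apply; under eq_bigr do rewrite scalerBl; rewrite sumrB.
rewrite [X in _ - X](bigD1 (enum_val i))//= eqxx scale1r.
rewrite [X in _ - (_ + X)]big1 ?addr0; last first.
  by move=> k' /negPf; rewrite eq_sym => ->; rewrite scale0r.
apply/eqP; rewrite subr_eq0; apply/eqP.
rewrite [RHS]bA; under eq_bigr do rewrite scaler_suml.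
rewrite exchange_big; apply: eq_bigr => j _.
by rewrite [in RHS]eC scaler_sumr; apply: eq_bigr => k' _; rewrite scalerA.
Qed.

Lemma is_basis_card S (I J : finType) (b : I -> mpoly d R)
    (e : J -> mpoly d R) :
  is_basis S b -> is_basis S e -> #|I| = #|J|.
Proof.
by move=> Sb Se; apply/eqP; rewrite eqn_leq !(@is_basis_card_le S _ _ b e,
  @is_basis_card_le S _ _ e b).
Qed.

Lemma poly_lt_le k m (p : mpoly d R) : (k <= m)%N -> poly_lt k p -> poly_lt m p.
Proof. by move=> km /leq_trans; apply. Qed.

Lemma poly_ltD m (p q : mpoly d R) : poly_lt m p -> poly_lt m q -> poly_lt m (p + q).
Proof.
move=> pm qm; apply: leq_trans (mmeasureD_le _ _ _) _.
by rewrite geq_max; apply/andP; split.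
Qed.

Lemma poly_ltZ m a (p : mpoly d R) : poly_lt m p -> poly_lt m (a *: p).
Proof. by move=> pm; apply: leq_trans pm; exact: mmeasureZ_le. Qed.

Lemma poly_lt_sum m (J : finType) (F : J -> mpoly d R) :
  (forall j, poly_lt m (F j)) -> poly_lt m (\sum_j F j).
Proof.
move=> Fm; elim/big_rec: _ => [|j p _]; last exact: poly_ltD.
by rewrite /poly_lt /= mmeasure0.
Qed.

Lemma poly_lt_mulX m i (p : mpoly d R) :
  poly_lt m p -> poly_lt m.+1 (mpolyX R (mnm1 i) * p).
Proof.
move=> pm; have [->|p0] := eqVneq p 0.
  by rewrite mulr0 /poly_lt /= mmeasure0.
have X0 : mpolyX R (mnm1 i) != 0.
  by rewrite -msize_poly_eq0 msizeX.
by rewrite /poly_lt /= msizeM// msizeX mdeg1.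
Qed.

Lemma pevalD (p q : mpoly d R) x : peval (p + q) x = peval p x + peval q x.
Proof. exact: mevalD. Qed.

Lemma pevalZ a (p : mpoly d R) x : peval (a *: p) x = a * peval p x.
Proof. exact: mevalZ. Qed.

Lemma pevalM (p q : mpoly d R) x : peval (p * q) x = peval p x * peval q x.
Proof. exact: mevalM. Qed.

Lemma peval_sum (J : finType) (F : J -> mpoly d R) x :
  peval (\sum_j F j) x = \sum_j peval (F j) x.
Proof.
apply: (big_morph (fun p => peval p x)) => [p q|]; first exact: pevalD.
exact: meval0.
Qed.

End Bases.

(** * Orthogonal polynomials of a positive definite functional *)

Section OrthogonalPolynomials.
Variables (R : realType) (d : nat) (L : mpoly d R -> R).
Hypothesis L_linear : scalar L.
Hypothesis L_gt0 : positive_definite L.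
Implicit Types (p q : mpoly d R) (P Q : multinom d -> mpoly d R).

Lemma functionalD p q : L (p + q) = L p + L q.
Proof. by have := L_linear 1 p q; rewrite scale1r mul1r. Qed.

Lemma functional0 : L 0 = 0.
Proof. by apply: (addrI (L 0)); rewrite -functionalD !addr0. Qed.

Lemma functionalZ a p : L (a *: p) = a * L p.
Proof. by have := L_linear a p 0; rewrite !addr0 functional0 addr0. Qed.

Lemma functionalB p q : L (p - q) = L p - L q.
Proof. by rewrite functionalD -scaleN1r functionalZ mulN1r. Qed.

Lemma functional_sum (J : finType) (F : J -> mpoly d R) :
  L (\sum_j F j) = \sum_j L (F j).
Proof. by apply: (big_morph L functionalD functional0). Qed.

Let ip p q := L (p * q).

Let ip_linear q : scalar (ip^~ q).
Proof. by move=> a p1 p2; rewrite /ip mulrDl -scalerAl L_linear. Qed.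

Let ipC p q : ip p q = ip q p. Proof. by rewrite /ip mulrC. Qed.

Lemma functional_sum_mull (J : finType) (c : J -> R) (F : J -> mpoly d R) p :
  L (p * \sum_j c j *: F j) = \sum_j c j * L (p * F j).
Proof.
by rewrite mulr_sumr functional_sum; apply: eq_bigr => j _;
  rewrite -scalerAr functionalZ.
Qed.

Lemma functional_sqr_eq0 p : L (p * p) = 0 -> p = 0.
Proof. by move=> Lp; apply/eqP; apply: contraT => /L_gt0; rewrite Lp ltxx. Qed.

Lemma orthonormal_free (J : finType) (q : J -> mpoly d R) :
  (forall i j, L (q i * q j) = (i == j)%:R) ->
  forall c : J -> R, \sum_j c j *: q j = 0 -> forall j, c j = 0.
Proof.
move=> q1 c c0 j.
by rewrite -(orthonormal_coord ip_linear c j q1) c0 /ip mul0r functional0.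
Qed.

(** Carries [gram_schmidt] from ordinals to an arbitrary index type by enumeration. As [S] is a bare
    set, its closure under combinations of [b] is a separate hypothesis, which keeps the new vectors
    in [S]. *)
Lemma orthonormal_basis (S : set (mpoly d R)) (J : finType)
    (b : J -> mpoly d R) :
  is_basis S b -> (forall v, in_span b v -> S v) ->
  exists q : J -> mpoly d R,
    is_basis S q /\ forall i j, L (q i * q j) = (i == j)%:R.
Proof.
move=> [Sb b_free b_gen] S_span.
pose b' (i : 'I_#|J|) := b (enum_val i).
have b'P v : in_span b v -> in_span b' v.
  apply: in_span_trans => j; rewrite -[j]enum_rankK.
  exact: (in_span_self b').
have bP v : in_span b' v -> in_span b v.
  by apply: in_span_trans => j; exact: in_span_self.
have [c b'c0 i|q' [q1 bq qb]] := gram_schmidt ip_linear ipC L_gt0 (b := b').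
  rewrite -(enum_valK i); apply: (b_free (fun j => c (enum_rank j))).
  rewrite -[RHS]b'c0 (big_enum_val (fun j => c (enum_rank j) *: b j)).
  by apply: eq_bigr => k _; rewrite enum_valK.
have q1' i j : L (q' (enum_rank i) * q' (enum_rank j)) = (i == j)%:R.
  by rewrite [LHS]q1 (inj_eq enum_rank_inj).
exists (fun j => q' (enum_rank j)); split=> //; split.
- by move=> j; exact/S_span/bP/bq.
- exact: orthonormal_free.
- move=> p /b_gen/b'P/(in_span_trans qb).
  apply: in_span_trans => i; rewrite -[i]enum_valK.
  exact: (in_span_self (fun j => q' (enum_rank j))).
Qed.

Lemma orth_space_span k (J : finType) (b : J -> mpoly d R) v :
  (forall j, orth_space L k (b j)) -> in_span b v -> orth_space L k v.
Proof.
move=> Vb [c ->]; split=> [|q qk].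
  by apply: poly_lt_sum => j; apply: poly_ltZ; have [] := Vb j.
rewrite mulrC functional_sum_mull big1// => j _.
by rewrite [q * _]mulrC; have [_ ->] := Vb j; rewrite ?mul0r ?mulr0.
Qed.

Definition orthonormal_below n Q :=
  [/\ forall k, (k < n)%N -> orth_basis L Q k
    & forall a b, (mdeg a < n)%N -> (mdeg b < n)%N ->
        L (Q a * Q b) = (a == b)%:R].

Lemma orthonormal_block P k : orth_basis L P k ->
  exists Q, orth_basis L Q k /\
    forall a b, mdeg a = k -> mdeg b = k -> L (Q a * Q b) = (a == b)%:R.
Proof.
move=> Pk; have [|q [qb q1]] := orthonormal_basis Pk.
  by move=> v; apply: orth_space_span; have [] := Pk.
pose ind (j : {a : bmultinom d k.+1 | mdeg a == k}) : multinom d := val (val j).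
(* [orth_basis] reads its block off a family over all multi-indices, so [q] is extended by 0 outside
   degree [k]. *)
pose Q a := if [pick j | ind j == a] is Some j then q j else 0.
have indI : injective ind by move=> i j /val_inj/val_inj.
have Qind j : Q (ind j) = q j.
  by rewrite /Q; case: pickP => [i /eqP/indI ->//|/(_ j)]; rewrite eqxx.
have indP a : mdeg a = k -> exists j, a = ind j.
  move=> ak; have ak1 : (mdeg a < k.+1)%N by rewrite ak.
  have ak' : mdeg (BMultinom ak1) == k by rewrite /= ak.
  by exists (exist _ (BMultinom ak1) ak').
exists Q; split=> [|_ _ /indP[i ->] /indP[j ->]].
  rewrite /orth_basis (_ : block Q (k := k) = q)//.
  by apply/funext => j; exact: Qind.
by rewrite !Qind q1 (inj_eq indI).
Qed.

Lemma orth_basis_degree P k a : orth_basis L P k -> mdeg a = k ->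
  orth_space L k (P a).
Proof.
move=> [Pk _ _] ak; have ak1 : (mdeg a < k.+1)%N by rewrite ak.
have ak' : mdeg (BMultinom ak1) == k by rewrite /= ak.
exact: (Pk (exist _ (BMultinom ak1) ak')).
Qed.

(** Elements of distinct V_k are orthogonal by definition, the one of lower degree being a test
    polynomial for the other. It is therefore enough to orthonormalise each block and to glue the
    blocks along [mdeg]. *)
Lemma exists_orthonormal n P : (forall k, (k < n)%N -> orth_basis L P k) ->
  exists Q, orthonormal_below n Q.
Proof.
move=> Pn.
have /choice[q qP] k : exists Q, (k < n)%N -> orth_basis L Q k /\
    forall a b, mdeg a = k -> mdeg b = k -> L (Q a * Q b) = (a == b)%:R.
  case: (ltnP k n) => [kn|_]; last by exists P.
  by have [Q ?] := orthonormal_block (Pn k kn); exists Q.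
have Qk k : (k < n)%N -> orth_basis L (fun a => q (mdeg a) a) k.
  move=> kn; have [qk _] := qP k kn.
  rewrite /orth_basis (_ : block _ (k := k) = block (q k) (k := k))//.
  by apply/funext => j; rewrite /block (eqP (valP j)).
exists (fun a => q (mdeg a) a); split=> // a b an bn.
have lt_orth a' b' : (mdeg a' < mdeg b')%N -> (mdeg b' < n)%N ->
    L (q (mdeg b') b' * q (mdeg a') a') = 0.
  move=> ab b'n; have [_ ->//] := orth_basis_degree (Qk _ b'n) (erefl (mdeg b')).
  have a'n := ltn_trans ab b'n.
  have [+ _] := orth_basis_degree (Qk _ a'n) (erefl (mdeg a')).
  exact: poly_lt_le.
have [ab|ab|ab] := ltngtP (mdeg a) (mdeg b).
- rewrite mulrC lt_orth//; case: eqP => // eab.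
  by rewrite eab ltnn in ab.
- rewrite lt_orth//; case: eqP => // eab.
  by rewrite eab ltnn in ab.
- by have [_] := qP _ bn; rewrite ab; apply.
Qed.

(** * Orthonormal expansions and the reproducing kernel *)

Section Orthonormal.
Variables (n : nat) (Q : multinom d -> mpoly d R).
Hypothesis Q_orthonormal : orthonormal_below n Q.

Lemma orthonormal_poly_lt m (a : bmultinom d m) : (m <= n)%N -> poly_lt m (Q a).
Proof.
move=> mn; have am := bmdeg a; have [Qb _] := Q_orthonormal.
have [+ _] := orth_basis_degree (Qb _ (leq_trans am mn)) (erefl (mdeg a)).
exact: poly_lt_le.
Qed.

Lemma orthonormal_bmultinom m (a b : bmultinom d m) : (m <= n)%N ->
  L (Q a * Q b) = (a == b)%:R.
Proof.
have [_ Q1] := Q_orthonormal.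
by move=> mn; rewrite Q1 ?(leq_trans (bmdeg _) mn).
Qed.

Lemma orthonormal_residue m p (a : bmultinom d m) : (m <= n)%N ->
  L ((p - \sum_(b : bmultinom d m) L (p * Q b) *: Q b) * Q a) = 0.
Proof.
move=> mn; rewrite mulrBl functionalB.
rewrite [X in _ - X](orthonormal_coord ip_linear) ?subrr// => i j.
exact: orthonormal_bmultinom.
Qed.

(** Induction on the degree bound. The residue [g] is orthogonal to all lower degrees by the
    induction hypothesis, so it lies in V_m and is a combination of the block of degree [m]. It is
    also orthogonal to that block, hence to itself. *)
Lemma orthonormal_expansion m p : (m <= n)%N -> poly_lt m p ->
  p = \sum_(b : bmultinom d m) L (p * Q b) *: Q b.
Proof.
elim: m p => [|m IHm] p mn pm.
  move: pm; rewrite /poly_lt /= leqn0 mmeasure_poly_eq0 => /eqP ->.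
  by rewrite big1// => b _; rewrite mul0r functional0 scale0r.
apply/eqP; rewrite -subr_eq0; apply/eqP.
have := orthonormal_residue p ^~ mn.
set g := _ - _ => gQ.
have gV : orth_space L m g.
  split=> [|q qm].
    apply: poly_ltD => //; rewrite -scaleN1r; apply/poly_ltZ/poly_lt_sum => b.
    exact/poly_ltZ/orthonormal_poly_lt.
  rewrite (IHm _ (ltnW mn) qm) functional_sum_mull big1// => b _.
  by have := gQ (BMultinom (leqW (bmdeg b))); rewrite /= => ->; rewrite mulr0.
have [Qb _] := Q_orthonormal; have [_ _ /(_ g gV)[c gc]] := Qb m mn.
apply: functional_sqr_eq0; rewrite [X in _ * X]gc functional_sum_mull big1// => j _.
by rewrite (gQ (val j)) mulr0.
Qed.

Lemma orthonormal_is_basis : is_basis (poly_lt n) (fun a : bmultinom d n => Q a).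
Proof.
split=> [a|c|p pn].
- exact: orthonormal_poly_lt.
- by apply: orthonormal_free => i j; exact: orthonormal_bmultinom.
- by exists (fun a : bmultinom d n => L (p * Q a)); exact: orthonormal_expansion.
Qed.

(** The Christoffel-Darboux kernel of the polynomials of degree below [n], with its first argument
    fixed at [x] and kept as a polynomial in the second. *)
Definition rep_kernel (x : 'rV[R]_d) : mpoly d R :=
  \sum_(a : bmultinom d n) peval (Q a) x *: Q a.

Lemma rep_kernelE x y :
  peval (rep_kernel x) y = \sum_(a : bmultinom d n) peval (Q a) x * peval (Q a) y.
Proof. by rewrite peval_sum; apply: eq_bigr => a _; rewrite pevalZ. Qed.

Lemma rep_kernelC x y : peval (rep_kernel x) y = peval (rep_kernel y) x.
Proof. by rewrite !rep_kernelE; apply: eq_bigr => a _; rewrite mulrC. Qed.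

Lemma rep_kernel_poly_lt x : poly_lt n (rep_kernel x).
Proof. by apply: poly_lt_sum => a; exact/poly_ltZ/orthonormal_poly_lt. Qed.

Variable P : multinom d -> mpoly d R.
Hypothesis P_basis : orth_basis L P n.

(* The bound is n.+1, not n: the component of [f] in V_n is in the span of
   P_n, hence vanishes at x. *)
Lemma rep_kernel_reproducing x f : variety (block P (k := n)) x ->
  poly_lt n.+1 f -> L (f * rep_kernel x) = peval f x.
Proof.
move=> Vx fn; rewrite functional_sum_mull.
pose g := f - \sum_(a : bmultinom d n) L (f * Q a) *: Q a.
have gV : orth_space L n g.
  split=> [|q qn].
    apply: poly_ltD => //; rewrite -scaleN1r; apply/poly_ltZ/poly_lt_sum => b.
    by apply: poly_ltZ; apply: poly_lt_le (orthonormal_poly_lt b _).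
  rewrite (orthonormal_expansion _ qn)// functional_sum_mull big1// => b _.
  by rewrite orthonormal_residue ?mulr0.
have [_ _ /(_ g gV)[c gc]] := P_basis.
have : peval g x = 0.
  rewrite gc peval_sum big1// => j _.
  by rewrite pevalZ Vx mulr0.
rewrite /g pevalD -scaleN1r pevalZ mulN1r => /eqP.
rewrite subr_eq0 => /eqP ->; rewrite peval_sum.
by apply: eq_bigr => a _; rewrite pevalZ mulrC.
Qed.

Lemma rep_kernel_eq0 x y : variety (block P (k := n)) x ->
  variety (block P (k := n)) y -> x != y -> peval (rep_kernel x) y = 0.
Proof.
move=> Vx Vy /eqP xy.
have [i xyi] : exists i, x ord0 i != y ord0 i.
  apply/not_existsP => xyE; apply: xy; apply/rowP => i.
  by apply/eqP; apply: contrapT => /negP; exact: xyE.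
pose X : mpoly d R := mpolyX R (mnm1 i).
have Xx z : peval X z = z ord0 i by rewrite /peval mevalXU.
(* Multiplication by a coordinate raises the degree from below [n] to at most [n], the last degree
   that the reproducing property reaches. *)
have XK z : poly_lt n.+1 (X * rep_kernel z).
  exact/poly_lt_mulX/rep_kernel_poly_lt.
have := rep_kernel_reproducing Vy (XK x).
rewrite mulrAC (rep_kernel_reproducing Vx (XK y)).
rewrite !pevalM !Xx (rep_kernelC y) => /eqP.
by rewrite -subr_eq0 -mulrBl mulf_eq0 subr_eq0 (negPf xyi) /= => /eqP.
Qed.

(** A vanishing sum of squares would make every [peval (Q a) x], and so the kernel itself, zero;
    reproducing the constant 1 at [x] would then give 0 = 1. *)
Lemma rep_kernel_gt0 x : variety (block P (k := n)) x ->
  0 < peval (rep_kernel x) x.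
Proof.
move=> Vx; rewrite lt_def rep_kernelE sumr_ge0 ?andbT; last first.
  by move=> a _; rewrite -expr2 sqr_ge0.
apply/negP => /eqP/psumr_eq0P Q0.
have K0 : rep_kernel x = 0.
  apply: big1 => a _; have /eqP := Q0 (fun b _ => sqr_ge0 (peval (Q b) x)) a isT.
  by rewrite mulf_eq0 orbb => /eqP ->; rewrite scale0r.
have p1 : poly_lt n.+1 (1 : mpoly d R) by rewrite /poly_lt /= msize1.
have /eqP := rep_kernel_reproducing Vx p1.
by rewrite mul1r K0 functional0 /peval meval1 eq_sym oner_eq0.
Qed.

End Orthonormal.
End OrthogonalPolynomials.

(** * Polynomials vanishing on a neighbourhood *)

Section PolynomialVanishing.
Variable R : realType.

Lemma poly_nbhs_eq0 (p : {poly R}) (x : R) (A : set R) :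
  nbhs x A -> (forall y, A y -> p.[y] = 0) -> p = 0.
Proof.
move=> /nbhs_ballP[e /= e0 eA] pA.
(* These are [size p] distinct roots, more than a nonzero [p] can have. The denominators start at 2
   to keep each point strictly inside the ball of radius [e]. *)
pose s := [seq x + e / k.+2%:R | k <- iota 0 (size p)].
apply: (@roots_geq_poly_eq0 _ p s); last by rewrite size_map size_iota.
- apply/allP => _ /mapP[k _ ->]; apply/rootP/pA/eA.
  rewrite /ball /= opprD addNKr normrN gtr0_norm ?divr_gt0//.
  by rewrite ltr_pdivrMr// ltr_pMr// ltr1n.
- rewrite map_inj_uniq ?iota_uniq// => i j /addrI/(mulfI (lt0r_neq0 e0))/invr_inj/eqP.
  by rewrite eqr_nat !eqSS => /eqP.
Qed.

(** Induction on the number of variables, with [p] read through [muni] as a univariate polynomial in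
    the last variable. With the other coordinates fixed in the box it vanishes near [x ord_max], so
    its coefficients vanish on the smaller box. Product neighbourhoods make this slicing
    possible. *)
Lemma mpoly_nbhs_eq0 n (p : mpoly n R) (x : 'I_n -> R) (A : 'I_n -> set R) :
  (forall i, nbhs (x i) (A i)) ->
  (forall v, (forall i, A i (v i)) -> meval v p = 0) -> p = 0.
Proof.
elim: n p x A => [|n IHn] p x A xA pA.
  have p0 : p = mpolyC 0 (mcoeff mnm0 p).
    apply/mpolyP => m; rewrite mcoeffC (_ : m = mnm0) ?eqxx ?mulr1//.
    by apply/mnmP => -[].
  rewrite p0 (_ : mcoeff mnm0 p = 0) ?mpolyC0//.
  by rewrite -(@mevalC 0 R (fun=> 0) (mcoeff mnm0 p)) -p0 pA//; case.
pose w := widen_ord (leqnSn n).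
pose trunc (m : multinom n.+1) := Multinom [tuple m (w i) : nat | i < n].
have trunc_inj m1 m2 : trunc m1 = trunc m2 -> m1 ord_max = m2 ord_max -> m1 = m2.
  move=> m12 m12_max; apply/mnmP => i.
  case: (unliftP ord_max i) => [j|] -> //.
  rewrite (_ : lift ord_max j = w j); last exact/val_inj/lift_max.
  by move/(congr1 (fun m : multinom n => m j)): m12; rewrite !mnmE.
(* A monomial is determined by its truncation and its last exponent, so no two terms of [p]
   merge. *)
have muni_coef m : mcoeff (trunc m) ((muni p)`_(m ord_max)) = mcoeff m p.
  rewrite muniE coef_sum raddf_sum /= [in RHS](mpolyE p) raddf_sum /=.
  apply: eq_bigr => m' _; rewrite coefZ coefXn !mcoeffZ mcoeffX.
  rewrite mulr_natr mcoeffMn mcoeffZ mcoeffX -mulrnAr; congr (_ * _).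
  case: (eqVneq m' m) => [->|m'm]; first by rewrite !eqxx.
  case: eqVneq => // mm_trunc; case: eqVneq => // mm_max.
  by case/eqP: m'm; apply: trunc_inj.
have muni_eval v : (map_poly (meval (v \o w)) (muni p)).[v ord_max] = meval v p.
  rewrite muniE rmorph_sum horner_sum [in RHS](mpolyE p) raddf_sum /=.
  apply: eq_bigr => m _.
  rewrite map_polyZ /= map_polyXn hornerZ hornerXn !mevalZ !mevalX -mulrA.
  rewrite [in RHS]big_ord_recr /=; congr (_ * (_ * _)).
  by apply: eq_bigr => i _; rewrite mnmE.
apply/mpolyP => m; rewrite mcoeff0 -muni_coef.
suff -> : (muni p)`_(m ord_max) = 0 by rewrite mcoeff0.
apply: (IHn _ (x \o w) (A \o w)) => [i|v' Av']; first exact: xA.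
rewrite -coef_map (_ : map_poly _ _ = 0) ?coef0//.
apply: (poly_nbhs_eq0 (xA ord_max)) => t At.
pose v i := oapp v' t (unlift ord_max i).
have vmax : v ord_max = t by rewrite /v unlift_none.
have vw i : v (w i) = v' i.
  by rewrite (_ : w i = lift ord_max i) ?/v ?liftK//; exact/val_inj/esym/lift_max.
have := muni_eval v; rewrite vmax (_ : v \o w = v'); last exact/funext.
move=> ->; apply: pA => i; case: (unliftP ord_max i) => [j|] ->; last by rewrite vmax.
rewrite (_ : lift ord_max j = w j); last exact/val_inj/lift_max.
by rewrite vw; exact: Av'.
Qed.

End PolynomialVanishing.

(** * Integration as a positive definite functional *)

Section IntegralFunctional.
Variables (R : realType) (d : nat) (mu : {measure set (borelRd R d) -> \bar R}).
Hypothesis mu_moments : finite_moments mu.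
Local Notation L := (integral_functional mu).

Lemma peval_continuous (p : mpoly d R) : continuous (peval p : 'rV[R]_d -> R).
Proof.
have -> : peval p = (fun x : 'rV[R]_d =>
    \sum_(m <- msupp p) mcoeff m p * \prod_i x ord0 i ^+ m i).
  by apply/funext => x; rewrite /peval mevalE.
apply: continuous_big => [|m _ x]; first exact: (@add_continuous R).
apply: (@continuousM R _ (fun=> mcoeff m p)
  (fun y : 'rV[R]_d => \prod_i y ord0 i ^+ m i) x); first exact: cst_continuous.
move: x; apply: continuous_big => [|i _ x]; first exact: (@mul_continuous R).
have := @continuous_comp _ _ _ (fun y : 'rV[R]_d => y ord0 i) (fun t => t ^+ m i) x.
apply; first exact: coord_continuous.
exact: exprn_continuous.
Qed.

Lemma integral_functional_linear : scalar L.
Proof.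
move=> a p q; rewrite /integral_functional.
under eq_Rintegral do rewrite pevalD pevalZ.
rewrite RintegralD ?RintegralZl//; try exact: mu_moments.
have := mu_moments (a *: p); congr integrable; apply/funext => x /=.
by rewrite pevalZ.
Qed.

(** If the integral of the square is 0, the open set where [p] is nonzero is null and so misses the
    support. Then [p] vanishes on the interior of the support, which forces [p = 0]. *)
Lemma integral_functional_gt0 : (measure_support mu)° !=set0 ->
  positive_definite L.
Proof.
move=> [x0 x0_supp] p p_neq0.
have Lp : (L (p * p))%:E = (\int[mu]_x `|(peval (p * p) x)%:E|)%E.
  rewrite fineK; last exact/integrable_fin_num.
  apply: eq_integral => x _.
  by rewrite pevalM -expr2 /= ger0_norm// sqr_ge0.
rewrite -lte_fin lt_neqAle Lp integral_ge0// andbT; apply/eqP => /esym.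
have /integrableP[mpp _] := mu_moments (p * p).
move=> /(ae_eq_integral_abs mu measurableT mpp)[N [mN N0 pN]].
pose U : set 'rV[R]_d := peval p @^-1` [set t | t != 0].
have U_open : open U.
  by apply: open_comp => [x _|]; [exact: peval_continuous|exact: open_neq].
have mU : measurable (U : set (borelRd R d)) by exact: sub_sigma_algebra.
have U0 : mu U = 0%E.
  apply: (subset_measure0 mU mN _ N0) => x /eqP px; apply: pN => /(_ I) [].
  by rewrite pevalM => /eqP; rewrite mulf_eq0 orbb => /eqP.
have p_supp x : measure_support mu x -> peval p x = 0.
  move=> x_supp; apply: contrapT => /eqP Ux.
  by have := x_supp U U_open Ux; rewrite U0 ltxx.
(* A neighbourhood of a row vector contains a product of entrywise neighbourhoods, the form taken by
   [mpoly_nbhs_eq0]. *)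
have [A xA A_supp] : nbhs x0 (measure_support mu) by [].
case/eqP: p_neq0; apply: (mpoly_nbhs_eq0 (xA ord0)) => v Av.
have <- : peval p (\row_i v i) = meval v p.
  by apply: meval_eq => i; rewrite mxE.
by apply/p_supp/A_supp => i j; rewrite ord1 mxE.
Qed.

End IntegralFunctional.

(** * The orthogonal Fourier matrix and the new signal model *)

Lemma orthogonal_mx_square (R : realType) m n (A : 'M[R]_(m, n)) :
  m = n -> A *m A^T = 1%:M -> orthogonal_mx A.
Proof. by move=> mn; subst n => AAT; split=> //; exact: mulmx1C. Qed.

Theorem theorem3 (R : realType) (d n : nat)
  (mu : {measure set (borelRd R d) -> \bar R})
  (mu_moments : finite_moments mu)
  (mu_support : (measure_support mu)° !=set0)
  (P : multinom d -> mpoly d R)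
  (P_basis : forall k, (k <= n)%N -> orth_basis (integral_functional mu) P k)
  (V_finite : finite_set (variety (block P (k := n))))
  (V_card : has_dim (@poly_lt R d n)
              #|` fset_set (variety (block P (k := n)))|%fset)
  (M1 : signal_model (block P (k := n)) (bmultinom d n))
  (M1_basis : has_basis M1 P) :
  exists (Q : multinom d -> mpoly d R)
         (M2 : signal_model (block P (k := n)) (bmultinom d n)),
    insignificantly_different M1 M2 P Q /\ orthogonal_fourier M2.
Proof.
set L := integral_functional mu; set F := block P (k := n); set V := variety F.
have L_lin : scalar L := integral_functional_linear mu_moments.
have L_gt0 : positive_definite L := integral_functional_gt0 mu_moments mu_support.
have Pn : orth_basis L P n by exact: P_basis.
have [Q Q1] : exists Q, orthonormal_below L n Q.
  by apply: (exists_orthonormal L_lin L_gt0 (P := P)) => k /ltnW; exact: P_basis.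
have Q_basis := orthonormal_is_basis L_lin L_gt0 Q1.
pose K := rep_kernel n Q.
pose a x := Num.sqrt (peval (K x) x).
have Vi (i : 'I_#|{: fset_set V}|) : V (val (enum_val i)).
  by have := valP (enum_val i); rewrite in_fset_set// => /set_mem.
have a_gt0 x : V x -> 0 < a x.
  by move=> Vx; rewrite sqrtr_gt0 (rep_kernel_gt0 L_lin L_gt0 Q1 Pn).
(* This is the Fourier matrix of the model to come, written down first because the bijectivity of
   that model's [Phi] is deduced from its orthogonality. *)
pose B : 'M[R]_(#|{: fset_set V}|, #|{: bmultinom d n}|) :=
  \matrix_(i, j) ((a (val (enum_val i)))^-1 *
                  peval (Q (enum_val j : bmultinom d n)) (val (enum_val i))).
(* [V_card] and [Q] give two bases of the same polynomial space, indexed by [|V|] ordinals and by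
   the multi-indices of degree below [n]. *)
have card_eq : #|{: fset_set V}| = #|{: bmultinom d n}|.
  have [b bP] := V_card.
  by rewrite -cardfE -(is_basis_card bP Q_basis) card_ord.
have B_orth : orthogonal_mx B.
  apply: orthogonal_mx_square => //; apply/matrixP => i k; rewrite !mxE.
  set x := val (enum_val i); set y := val (enum_val k).
  have -> : \sum_j B i j * B^T j k = (a x)^-1 * (a y)^-1 * peval (K x) y.
    rewrite rep_kernelE mulr_sumr [RHS](big_enum_val (fun j : bmultinom d n =>
      (a x)^-1 * (a y)^-1 * (peval (Q j) x * peval (Q j) y))).
    by apply: eq_bigr => j _; rewrite !mxE mulrACA.
  have [ik|ik] := eqVneq i k.
    rewrite /y -ik -/x -invfM -expr2 sqr_sqrtr ?mulVf ?gt_eqF ?ltW//;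
      exact: (rep_kernel_gt0 L_lin L_gt0 Q1 Pn (Vi i)).
  rewrite (rep_kernel_eq0 L_lin L_gt0 Q1 Pn (Vi i) (Vi k)) ?mulr0//.
  by apply: contra_neq ik => /val_inj/enum_val_inj.
pose b (j : bmultinom d n) : quot_alg F := \pi_(quot_alg F) (Q j).
have pi_sum (c : bmultinom d n -> R) (T : bmultinom d n -> mpoly d R) :
    \sum_j c j *: (\pi_(quot_alg F) (T j) : quot_alg F) =
    \pi_(quot_alg F) (\sum_j c j *: T j).
  elim/big_rec2: _ => [|j x p _ ->]; first by rewrite !piE.
  by rewrite Defs.pi_add Defs.pi_scale.
(* If two coordinate vectors give the same class, the difference [p] of their polynomials vanishes
   on the variety. Its coefficient vector is then killed by [B], hence zero. *)
have b_inj : injective (coord_map b).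
  move=> s t st; pose p := \sum_j (s j - t j) *: Q (j : bmultinom d n).
  have pi_p : \pi_(quot_alg F) p = \pi_(quot_alg F) 0.
    rewrite -pi_sum; under eq_bigr do rewrite scalerBl.
    by rewrite sumrB [X in X - _]st subrr piE.
  pose c := \col_(j < #|{: bmultinom d n}|) (s (enum_val j) - t (enum_val j)).
  have Bc0 : B *m c = 0.
    apply/colP => i; rewrite [RHS]mxE.
    have : (a (val (enum_val i)))^-1 * peval p (val (enum_val i)) = 0.
      by rewrite -(fourier_pi p (Vi i)) pi_p (fourier_pi 0 (Vi i)) /peval meval0 mulr0.
    move=> <-; rewrite mxE peval_sum mulr_sumr.
    rewrite [RHS](big_enum_val (fun j : bmultinom d n =>
      (a (val (enum_val i)))^-1 * peval ((s j - t j) *: Q j) (val (enum_val i)))).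
    by apply: eq_bigr => j _; rewrite !mxE pevalZ mulrCA mulrA mulrC -!mulrA mulrCA.
  have c0 : c = 0.
    by have [_ BTB] := B_orth; rewrite -[c]mul1mx -BTB -mulmxA Bc0 mulmx0.
  apply/ffunP => j; apply/eqP; rewrite -subr_eq0; apply/eqP.
  by move/colP/(_ (enum_rank j)): c0; rewrite !mxE enum_rankK.
(* Spanning is inherited from [M1]: each class has a representative of degree below [n], a
   combination of the [P a], which expands in [Q]. *)
have b_surj y : exists s, coord_map b s = y.
  have [g _ gK] := Phi_bij M1; rewrite -[y]gK /Phi /coord_map.
  under [in X in exists _, _ = X]eq_bigr do rewrite M1_basis.
  rewrite pi_sum; set p := \sum_j _.
  have pn : poly_lt n p.
    apply: poly_lt_sum => j; apply: poly_ltZ.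
    have jn := bmdeg j; have Pj := P_basis _ (ltnW jn).
    have [+ _] := orth_basis_degree Pj (erefl (mdeg j)).
    exact: poly_lt_le.
  have [_ _ /(_ p pn)[c ->]] := Q_basis.
  exists [ffun j => c j]; rewrite -pi_sum.
  by apply: eq_bigr => j _; rewrite ffunE.
have b_bij : bijective (coord_map b).
  have /choice[g gP] := b_surj.
  by exists g => // s; apply: b_inj; rewrite gP.
exists Q, (SignalModel b_bij); split.
  split=> //; exists L; split=> // k kn; split; first exact/P_basis/ltnW.
  by have [Qb _] := Q1; exact: Qb.
exists a; split=> [x Vx|]; first by rewrite gt_eqF// a_gt0.
rewrite (_ : fourier_mx _ _ = B)//; apply/matrixP => i j.
by rewrite !mxE /= fourier_pi//; exact: Vi.
Qed.
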